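(* Let $\mathbb{K}\in\{\mathbb{R},\mathbb{C}\}$, let $(X,\Sigma)$ be a measurable space, $H$ a Hilbert space over $\mathbb{K}$ and let $\Phi:\mathcal{M}_{\mathrm{b}}(X,\Sigma)\to\mathcal{L}(H)$ be a unital and (weakly) bp-continuous $*$-homomorphism. Then $\Phi$ extends uniquely to a measurable functional calculus $\mathcal{M}(X,\Sigma)\to\mathcal{C}(H)$.
   Context: For a measurable space $(X,\Sigma)$ let $\mathcal{M}(X,\Sigma)$ be the algebra of measurable functions $X\to\mathbb{K}$ and $\mathcal{M}_{\mathrm{b}}(X,\Sigma)$ the subalgebra of bounded ones; both are unital $*$-algebras under pointwise operations, with complex conjugation as involution (trivial if $\mathbb{K}=\mathbb{R}$). A sequence $(f_n)_n$ of bounded measurable functions bp-converges (converges ''pointwise and boundedly'') to $f$ if $\sup_n\|f_n\|_\infty<\infty$ and $f_n\to f$ pointwise. A map $\Phi$ on $\mathcal{M}_{\mathrm{b}}(X,\Sigma)$ is weakly bp-continuous if $\Phi(f_n)\to\Phi(f)$ in the weak operator topology whenever $f_n\to f$ pointwise and boundedly. A $*$-homomorphism is $\mathbb{K}$-linear, multiplicative and satisfies $\Phi(\overline f)=\Phi(f)^*$. For a Hilbert space $H$ let $\mathcal{C}(H)$ be the set of closed linear operators in $H$ (linear, defined on a subspace $\mathrm{dom}\subseteq H$, with closed graph; not assumed densely defined) and $\mathcal{L}(H)$ the bounded everywhere defined ones. Sums and products of operators have their natural (maximal) domains and $A\subseteq B$ means inclusion of graphs. A measurable (functional) calculus on $(X,\Sigma)$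 is a pair $(\Phi,H)$, $H$ a Hilbert space over $\mathbb{K}$, $\Phi:\mathcal{M}(X,\Sigma)\to\mathcal{C}(H)$, such that for all $f,g\in\mathcal{M}(X,\Sigma)$, $\lambda\in\mathbb{K}$: (MFC1) $\Phi(\mathbf{1})=\mathrm{I}$; (MFC2) $\Phi(f)+\Phi(g)\subseteq\Phi(f+g)$ and $\lambda\Phi(f)\subseteq\Phi(\lambda f)$; (MFC3) $\Phi(f)\Phi(g)\subseteq\Phi(fg)$ and $\mathrm{dom}(\Phi(f)\Phi(g))=\mathrm{dom}(\Phi(g))\cap\mathrm{dom}(\Phi(fg))$; (MFC4) $\Phi(f)\in\mathcal{L}(H)$ and $\Phi(f)^*=\Phi(\overline{f})$ if $f$ is bounded; (MFC5) if $f_n\to f$ pointwise and boundedly, then $\Phi(f_n)\to\Phi(f)$ weakly. *)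

(* Defs.v *)
From HB Require Import structures.
From mathcomp Require Import all_boot all_order all_algebra.
From mathcomp Require Import all_classical all_reals all_analysis.
From mathcomp Require Import complex.

Set Implicit Arguments.
Unset Strict Implicit.
Unset Printing Implicit Defensive.
Import Order.TTheory GRing.Theory Num.Theory.
Import numFieldNormedType.Exports.
Local Open Scope classical_set_scope.
Local Open Scope ring_scope.

Variant scalar_kind := RealScalars | ComplexScalars.

Definition scalar_field (R : realType) (k : scalar_kind) : numFieldType :=
  match k with
  | RealScalars => R
  | ComplexScalars => R[i]
  end.

Definition sconj (R : realType) (k : scalar_kind) : scalar_field R k -> scalar_field R k :=
  match k with
  | RealScalars => idfun
  | ComplexScalars => @conjc R
  end.

(* The sigma-algebra is a bare set of sets rather than a [measurableType],
   because the latter is pointed and would exclude the empty space. *)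
Section measurable_functions.
Context (K : numFieldType) (X : Type) (Sigma : set (set X)).

Definition meas_fun : set (X -> K) :=
  [set f | forall B : set K, <<s @open K >> B -> Sigma (f @^-1` B)].

Definition bmeas_fun : set (X -> K) := meas_fun `&` bounded_fun.

Definition bp_cvg (f_ : nat -> X -> K) (f : X -> K) : Prop :=
  (exists M : K, forall n x, `|f_ n x| <= M) /\
  (forall x, f_ ^~ x @ \oo --> f x).

End measurable_functions.
Arguments meas_fun K {X} Sigma.
Arguments bmeas_fun K {X} Sigma.

(* Operators in [H] are identified with their graphs, so that inclusion of
   operators is [`<=`].  [linear_op] singles out the graphs of linear maps
   defined on a subspace. *)
Definition operator (K : numFieldType) (H : normedModType K) := set (H * H).

Section operators.
Context (K : numFieldType) (H : normedModType K).
Implicit Types A B : operator H.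

Definition op_dom A : set H := [set x | exists y, A (x, y)].

Definition linear_op A : Prop :=
  [/\ A (0, 0),
      forall (a : K) (x x' y y' : H),
        A (x, y) -> A (x', y') -> A (a *: x + x', a *: y + y') &
      forall x y y', A (x, y) -> A (x, y') -> y = y'].

Definition closed_op : set (operator H) := [set A | linear_op A /\ closed A].

Definition bounded_op : set (operator H) := [set A |
  [/\ linear_op A, op_dom A = setT &
      exists M : K, forall x y, A (x, y) -> `|y| <= M * `|x|]].

Definition op_id : operator H := [set p | p.2 = p.1].

Definition op_add A B : operator H :=
  [set p | exists y z, [/\ A (p.1, y), B (p.1, z) & p.2 = y + z]].

Definition op_scale (a : K) A : operator H :=
  [set p | exists2 y, A (p.1, y) & p.2 = a *: y].

Definition op_comp A B : operator H :=
  [set p | exists2 y, B (p.1, y) & A (y, p.2)].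

(* The value of [A] at [x]; only meaningful for [x] in the domain of [A]. *)
Definition op_app A (x : H) : H := xget 0 [set y | A (x, y)].

End operators.

Section hilbert_space_operators.
Context (K : numFieldType) (conj : K -> K) (H : normedModType K).

(* [ip] is linear in its first argument.  Together with the completeness of
   [H], this hypothesis makes [H] a Hilbert space. *)
Definition induces_norm (ip : {dot H for conj}) : Prop :=
  forall x : H, `|x| ^+ 2 = ip x x.

Context (ip : {dot H for conj}).

Definition adjoint (A : operator H) : operator H :=
  [set p | forall x y, A (x, y) -> ip y p.1 = ip x p.2].

Definition wop_cvg (A_ : nat -> operator H) (A : operator H) : Prop :=
  forall x y, (fun n => ip (op_app (A_ n) x) y) @ \oo --> ip (op_app A x) y.

Context (X : Type) (Sigma : set (set X)).

(* In the definitions below, a map on measurable functions is represented by a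
   map on all functions whose values elsewhere are irrelevant. *)

Definition weakly_bp_continuous (Phi : (X -> K) -> operator H) : Prop :=
  forall (f_ : nat -> X -> K) (f : X -> K),
    (forall n, bmeas_fun K Sigma (f_ n)) -> bmeas_fun K Sigma f ->
    bp_cvg f_ f -> wop_cvg (fun n => Phi (f_ n)) (Phi f).

Definition unital_star_hom (Phi : (X -> K) -> operator H) : Prop :=
  [/\ forall f, bmeas_fun K Sigma f -> bounded_op (Phi f),
      Phi (fun=> 1) = @op_id K H,
      (forall f g, bmeas_fun K Sigma f -> bmeas_fun K Sigma g ->
        Phi (fun x => f x + g x) = op_add (Phi f) (Phi g)) /\
      (forall (a : K) f, bmeas_fun K Sigma f ->
        Phi (fun x => a * f x) = op_scale a (Phi f)),
      forall f g, bmeas_fun K Sigma f -> bmeas_fun K Sigma g ->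
        Phi (fun x => f x * g x) = op_comp (Phi f) (Phi g) &
      forall f, bmeas_fun K Sigma f ->
        Phi (fun x => conj (f x)) = adjoint (Phi f)].

Record measurable_calculus (Phi : (X -> K) -> operator H) : Prop := {
  mfc_closed : forall f, meas_fun K Sigma f -> closed_op (Phi f);
  mfc1 : Phi (fun=> 1) = @op_id K H;
  mfc2_add : forall f g, meas_fun K Sigma f -> meas_fun K Sigma g ->
    op_add (Phi f) (Phi g) `<=` Phi (fun x => f x + g x);
  mfc2_scale : forall (a : K) f, meas_fun K Sigma f ->
    op_scale a (Phi f) `<=` Phi (fun x => a * f x);
  mfc3_sub : forall f g, meas_fun K Sigma f -> meas_fun K Sigma g ->
    op_comp (Phi f) (Phi g) `<=` Phi (fun x => f x * g x);
  mfc3_dom : forall f g, meas_fun K Sigma f -> meas_fun K Sigma g ->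
    op_dom (op_comp (Phi f) (Phi g)) =
    op_dom (Phi g) `&` op_dom (Phi (fun x => f x * g x));
  mfc4_bounded : forall f, bmeas_fun K Sigma f -> bounded_op (Phi f);
  mfc4_adjoint : forall f, bmeas_fun K Sigma f ->
    adjoint (Phi f) = Phi (fun x => conj (f x));
  mfc5 : weakly_bp_continuous Phi }.

Definition extends (Psi Phi : (X -> K) -> operator H) : Prop :=
  forall f, bmeas_fun K Sigma f -> Psi f = Phi f.

End hilbert_space_operators.

(* Main.v *)
Require Import Defs.
From HB Require Import structures.
From mathcomp Require Import all_boot all_order all_algebra.
From mathcomp Require Import all_classical all_reals all_analysis.
From mathcomp Require Import complex ring lra.

Set Implicit Arguments.
Unset Strict Implicit.
Unset Printing Implicit Defensive.
Import Order.TTheory GRing.Theory Num.Theory.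
Import numFieldNormedType.Exports.
Local Open Scope classical_set_scope.
Local Open Scope ring_scope.

(** Let f be measurable.  Multiplying f by e = 1 / (1 + |f|) makes it bounded,
    so Phi (e f) and Phi e are available, and in any calculus extending Phi the
    value at f has to be the quotient Phi(e)^-1 Phi(e f).  Accordingly [ext]
    puts (x, y) in the graph of the extension at f when
    Phi (e f) x = Phi e y for every bounded e such that e f is bounded.  Written
    this way the graph is visibly a closed subspace and no choice is involved.

    Everything rests on one analytic fact, [app_inj]: if d is bounded and
    everywhere positive then Phi d is injective.  Indeed
    h_n = 1 / (1/(n+1) + d) is bounded and h_n d converges to 1 pointwise and
    boundedly, so Phi d x = 0 forces x = lim Phi(h_n) (Phi d x) = 0 weakly.
    It follows that the condition defining [ext] need only be tested at a single
    positive e ([extP]): the other ones follow after cancelling Phi e.  The axioms of a calculus then become identities between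
    bounded commuting operators, obtained by testing sums and products of f
    and g at the product of their two damping factors.

    Uniqueness ([ext_unique]) is algebraic too.  Let Psi be a calculus
    extending Phi and d = 1 / (1 + |f|).  Multiplicativity gives
    Psi d Psi f contained in Phi (d f), hence Psi f contained in ext f.
    Conversely the domain condition for the product of 1/d and d makes
    Psi (1/d) inverse to Phi d, and Psi (1/d) Phi (d f), which is contained in
    Psi f, contains ext f.

    The facts about measurable functions hold over any scalar field with a
    countable dense subset in which 1/(n+1) tends to 0; the real and the complex
    numbers enter only through these two properties and through the
    conjugation being isometric. *)

(** * The scalar fields *)

Definition has_dense_seq (K : numFieldType) : Prop :=
  exists D : nat -> K, forall z e : K, 0 < e -> exists n, `|z - D n| < e.

Definition archimedean_inv (K : numFieldType) : Prop :=
  forall e : K, 0 < e -> exists n, n.+1%:R^-1 < e.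

Lemma scalar_archimedean (R : realType) (k : scalar_kind) :
  archimedean_inv (scalar_field R k).
Proof.
have AR (e : R) : 0 < e -> exists n, n.+1%:R^-1 < e.
  move=> e0; exists (Num.truncn e^-1).
  by rewrite invf_plt ?posrE// truncnS_gt ?invr_ge0 ?ltW.
case: k => // e; rewrite /= ltcE /= => /andP[/eqP Ie Re].
have [n ne] := AR _ Re; exists n.
have -> : (n.+1%:R : R[i]) = (n.+1%:R : R)%:C%C by rewrite rmorph_nat.
by rewrite -fmorphV ltcE /= Ie eqxx.
Qed.

Lemma scalar_dense_seq (R : realType) (k : scalar_kind) :
  has_dense_seq (scalar_field R k).
Proof.
have DR (x e : R) : 0 < e -> exists q : rat, `|x - ratr q| < e.
  move=> e0; have [|q] := @rat_in_itvoo R (x - e) (x + e).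
    by rewrite ltrBlDr -addrA ltrDl addr_gt0.
  rewrite in_itv /= => /andP[q1 q2]; exists q.
  by rewrite ltr_distlC q1 q2.
rewrite /has_dense_seq; case: k => /=.
- pose D n : R := ratr (odflt 0 (unpickle n)).
  exists D => z e /(DR z)[q qe].
  by exists (pickle q); rewrite /D pickleK.
- pose D n : R[i] := let p : rat * rat := odflt (0, 0) (unpickle n) in
    (ratr p.1 +i* ratr p.2)%C.
  exists D => -[a b] e.
  rewrite /= ltcE /= => /andP[/eqP Ie Re].
  have Re2 : 0 < complex.Re e / 2 by rewrite divr_gt0.
  have [q1 q1e] := DR a _ Re2; have [q2 q2e] := DR b _ Re2.
  exists (pickle (q1, q2)); rewrite /D pickleK /= normc_def ltcE /= Ie eqxx /=.
  (* Each coordinate is off by less than Re e / 2, and the sum of the two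
     squares is at most half of (Re e)^2. *)
  rewrite -(@ltr_sqr _ _ (complex.Re e)) ?nnegrE ?sqrtr_ge0 ?ltW//.
  rewrite sqr_sqrtr ?addr_ge0 ?sqr_ge0//.
  move: q1e q2e; rewrite !ltr_norml; nra.
Qed.

Lemma normr_sconj (R : realType) (k : scalar_kind) (a : scalar_field R k) :
  `|@sconj R k a| = `|a|.
Proof. by case: k a => // a; exact: normcJ. Qed.

Lemma isometry_continuous (K : numFieldType) (V W : normedModType K)
    (c : V -> W) : (forall a b, `|c a - c b| = `|a - b|) -> continuous c.
Proof.
move=> isoc a; apply/cvgrPdist_lt => e e0; near=> b; rewrite isoc.
near: b; exact: (@cvgr_dist_lt _ _ _ (nbhs a) _ id a (@cvg_id _ _) _ e0).
Unshelve. all: by end_near. Qed.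

Lemma continuous_sconj (R : realType) (k : scalar_kind) :
  continuous (@sconj R k).
Proof.
apply: (@isometry_continuous (scalar_field R k) (scalar_field R k)
  (scalar_field R k)) => a b.
by rewrite -[RHS]normr_sconj; case: k a b => //= a b; rewrite rmorphB.
Qed.

(** * Measurable functions *)

Section measurability.
Context (K : numFieldType) (X : Type) (Sigma : set (set X)).
Hypothesis SigmaP : sigma_algebra setT Sigma.
Implicit Types (f g : X -> K).

(** The sets with measurable preimage form a sigma-algebra. *)
Lemma meas_fun_openP f :
  meas_fun K Sigma f <-> forall U : set K, open U -> Sigma (f @^-1` U).
Proof.
split=> [mf U oU|mf B]; first by apply: mf; exact: sub_sigma_algebra.
have [S0 SC SU] := SigmaP.
apply: (smallest_sub (X := [set B | Sigma (f @^-1` B)])) => //; split=> /=.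
- by rewrite preimage_set0.
- by move=> A /SC; rewrite !setTD preimage_setC.
- by move=> A /SU; rewrite preimage_bigcup.
Qed.

Lemma meas_fun_cont f (phi : K -> K) : continuous phi ->
  meas_fun K Sigma f -> meas_fun K Sigma (phi \o f).
Proof.
move=> cphi /meas_fun_openP mf; apply/meas_fun_openP => U oU.
by rewrite comp_preimage; apply: mf; move/continuousP : cphi; exact.
Qed.

(** An open subset of the plane is a union of countably many squares, with
    centres in the dense sequence and radii 1/(m+1). *)
Lemma meas_fun_cont2 f g (phi : K * K -> K) :
  has_dense_seq K -> archimedean_inv K -> continuous phi ->
  meas_fun K Sigma f -> meas_fun K Sigma g ->
  meas_fun K Sigma (fun x => phi (f x, g x)).
Proof.
move=> [D dD] arK cphi /meas_fun_openP mf /meas_fun_openP mg.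
apply/meas_fun_openP => U oU.
have {cphi} oV : open (phi @^-1` U) by move/continuousP : cphi; exact.
have [S0 _ SU] := SigmaP.
have SI A B : Sigma A -> Sigma B -> Sigma (A `&` B).
  by move: SigmaP; rewrite sigma_algebraP// => -[_ _ _]; exact.
pose rect i j m := ball (D i) (m.+1%:R^-1 : K) `*` ball (D j) (m.+1%:R^-1 : K).
have -> : (fun x => phi (f x, g x)) @^-1` U =
    \bigcup_i \bigcup_j \bigcup_m
      [set x | rect i j m `<=` phi @^-1` U /\ rect i j m (f x, g x)].
  apply/seteqP; split=> [x Ux|x [i _ [j _ [m _ [sub /sub]]]]]//.
  have /nbhs_ballP[e /= e0 eU] : nbhs (f x, g x) (phi @^-1` U) by exact: oV.
  have [|m me] := arK (e / 2); first by rewrite divr_gt0.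
  have m0 : 0 < m.+1%:R^-1 :> K by rewrite invr_gt0.
  have [i fi] := dD (f x) _ m0; have [j gj] := dD (g x) _ m0.
  exists i => //; exists j => //; exists m => //; split; last first.
    by split; rewrite /= -ball_normE /= distrC.
  move=> [a b] [/=]; rewrite -!ball_normE /= => ai bj.
  apply: eU; split; rewrite -ball_normE /= (splitr e).
  - rewrite -(subrK (D i) (f x)) -addrA (le_lt_trans (ler_normD _ _))//.
    by rewrite ltrD// (lt_trans _ me).
  - rewrite -(subrK (D j) (g x)) -addrA (le_lt_trans (ler_normD _ _))//.
    by rewrite ltrD// (lt_trans _ me).
apply: (SU) => i; apply: (SU) => j; apply: (SU) => m.
(* Squares that stick out of the open set contribute the empty set. *)
have [sub|nsub] := pselect (rect i j m `<=` phi @^-1` U); last first.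
  rewrite [X in Sigma X](_ : _ = set0)//.
  by apply/seteqP; split=> // x [].
rewrite [X in Sigma X](_ : _ =
  f @^-1` ball (D i) m.+1%:R^-1 `&` g @^-1` ball (D j) m.+1%:R^-1).
  by apply: SI; [apply: mf|apply: mg]; exact: ball_open.
by apply/seteqP; split=> [x [_ []]|x []].
Qed.

End measurability.

(** * Bounded measurable functions and damping factors *)

Lemma bounded_funP (K : numFieldType) (X : Type) (f : X -> K) :
  bounded_fun f <-> exists M : K, forall x, `|f x| <= M.
Proof.
split=> [[M [Mr bM]]|[M bM]].
  by exists (M + 1) => x; apply: bM => //; rewrite ltrDl.
(* The order may be partial: M itself need not be real when X is empty. *)
exists `|M|; split=> [|N MN x _ /=]; first exact: normr_real.
apply: le_trans (bM x) _.
by rewrite -[M]ger0_norm ?(le_trans _ (bM x))// ltW.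
Qed.

Section bounded_measurable_functions.
Context (K : numFieldType) (X : Type) (Sigma : set (set X)).
Hypotheses (SigmaP : sigma_algebra setT Sigma).
Hypotheses (denseK : has_dense_seq K) (archK : archimedean_inv K).
Implicit Types (f g : X -> K).

Lemma meas_fun_norm1 f :
  meas_fun K Sigma f -> meas_fun K Sigma (fun x => 1 + `|f x|).
Proof.
apply: (meas_fun_cont SigmaP (phi := fun z : K => 1 + `|z|)) => z.
by apply: (@cvgD _ _ _ (nbhs z)); [exact: cvg_cst|exact: norm_continuous].
Qed.

Lemma bmeas_fun_cst (a : K) : bmeas_fun K Sigma (fun=> a).
Proof.
split; last by apply/bounded_funP; exists `|a|.
apply/meas_fun_openP => // U _; rewrite preimage_cst.
by case: ifP => _; move: SigmaP; [rewrite sigma_algebraP// => -[]|case].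
Qed.

Lemma bmeas_funD f g : bmeas_fun K Sigma f -> bmeas_fun K Sigma g ->
  bmeas_fun K Sigma (fun x => f x + g x).
Proof.
move=> [mf /bounded_funP[M fM]] [mg /bounded_funP[N gN]]; split.
  apply: (meas_fun_cont2 SigmaP (phi := fun p => p.1 + p.2)) => // z.
  by apply: (@cvgD _ _ _ (nbhs z)); [exact: cvg_fst|exact: cvg_snd].
apply/bounded_funP; exists (M + N) => x.
by rewrite (le_trans (ler_normD _ _))// lerD.
Qed.

Lemma bmeas_funM f g : bmeas_fun K Sigma f -> bmeas_fun K Sigma g ->
  bmeas_fun K Sigma (fun x => f x * g x).
Proof.
move=> [mf /bounded_funP[M fM]] [mg /bounded_funP[N gN]]; split.
  apply: (meas_fun_cont2 SigmaP (phi := fun p => p.1 * p.2)) => // z.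
  by apply: (@cvgM _ _ (nbhs z)); [exact: cvg_fst|exact: cvg_snd].
apply/bounded_funP; exists (M * N) => x.
by rewrite normrM ler_pM.
Qed.

Lemma bmeas_funZ (a : K) f : bmeas_fun K Sigma f ->
  bmeas_fun K Sigma (fun x => a * f x).
Proof.
move=> [mf /bounded_funP[M fM]]; split.
  apply: (meas_fun_cont SigmaP (phi := fun z : K => a * z)) mf.
  exact: mulrl_continuous.
apply/bounded_funP; exists (`|a| * M) => x.
by rewrite normrM ler_wpM2l.
Qed.

(** Depending on e, this function is either a factor making f bounded (e = 1)
    or a bounded approximation of 1 / f for positive f (e close to 0). *)
Definition damping (e : K) f : X -> K := fun x => (e + `|f x|)^-1.

Lemma damping_gt0 e f x : 0 < e -> 0 < damping e f x.
Proof. by move=> e0; rewrite invr_gt0 ltr_wpDr. Qed.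

Lemma continuous_damping (e : K) : 0 < e ->
  continuous (fun z : K => (e + `|z|)^-1).
Proof.
move=> e0 z; apply: (@cvgV _ _ (nbhs z)); first by rewrite gt_eqF// ltr_wpDr.
by apply: (@cvgD _ _ _ (nbhs z)); [exact: cvg_cst|exact: norm_continuous].
Qed.

Lemma bmeas_damping e f : 0 < e -> meas_fun K Sigma f ->
  bmeas_fun K Sigma (damping e f).
Proof.
move=> e0 mf; split.
  exact: (meas_fun_cont SigmaP (continuous_damping e0)).
apply/bounded_funP; exists e^-1 => x.
by rewrite gtr0_norm ?damping_gt0// lef_pV2 ?posrE ?lerDl// ltr_wpDr.
Qed.

Lemma damping_le1 e f x : 0 < e -> `|damping e f x * f x| <= 1.
Proof.
move=> e0; rewrite normrM gtr0_norm ?damping_gt0//.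
rewrite mulrC ler_pdivrMr ?ltr_wpDr//.
by rewrite mul1r lerDr ltW.
Qed.

Lemma bmeas_dampingM e f : 0 < e -> meas_fun K Sigma f ->
  bmeas_fun K Sigma (fun x => damping e f x * f x).
Proof.
move=> e0 mf; split.
  apply: (meas_fun_cont SigmaP (phi := fun z => (e + `|z|)^-1 * z)) => // z.
  by apply: (@cvgM _ _ (nbhs z)); [exact: continuous_damping|exact: cvg_id].
by apply/bounded_funP; exists 1 => x; exact: damping_le1.
Qed.

Lemma bp_cvg_damping f : (forall x, 0 < f x) ->
  bp_cvg (fun n x => damping n.+1%:R^-1 f x * f x) (fun=> 1).
Proof.
move=> f0; split.
  by exists 1 => n x; apply: damping_le1; rewrite invr_gt0.
move=> x; apply/cvgrPdist_lt => e e0.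
have [|N Ne] := archK (e := e * f x); first by rewrite mulr_gt0.
exists N => // n /= Nn; rewrite /damping (gtr0_norm (f0 x)).
set d : K := n.+1%:R^-1.
have d0 : 0 < d by rewrite invr_gt0.
have df0 : 0 < d + f x by rewrite addr_gt0.
rewrite (_ : 1 - _ = d / (d + f x)); last first.
  by field; rewrite gt_eqF.
rewrite gtr0_norm ?divr_gt0// ltr_pdivrMr//.
apply: (@le_lt_trans _ _ N.+1%:R^-1).
  by rewrite lef_pV2 ?posrE// ler_nat.
by rewrite (lt_le_trans Ne)// ler_pM2l// lerDr ltW.
Qed.

End bounded_measurable_functions.

(** * The bounded calculus *)

Lemma op_appE (K : numFieldType) (H : normedModType K)
    (A : operator H) x y :
  linear_op A -> A (x, y) -> op_app A x = y.
Proof.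
move=> [_ _ uniA] Axy; apply: (uniA x) => //.
exact: (xgetI (P := [set z | A (x, z)]) 0 Axy).
Qed.

Lemma bounded_opP (K : numFieldType) (H : normedModType K)
    (A : operator H) x y :
  bounded_op A -> A (x, y) <-> op_app A x = y.
Proof.
move=> [linA domA _]; split=> [|<-]; first exact: op_appE.
have [z Axz] : op_dom A x by rewrite domA.
by rewrite (op_appE linA Axz).
Qed.

Section extension.
Context (K : numFieldType) (conj : K -> K) (H : normedModType K).
Context (ip : {dot H for conj}) (X : Type) (Sigma : set (set X)).
Hypotheses (SigmaP : sigma_algebra setT Sigma).
Hypotheses (denseK : has_dense_seq K) (archK : archimedean_inv K).
Hypothesis ipP : induces_norm ip.
Variable Phi : (X -> K) -> operator H.
Hypotheses (PhiM : unital_star_hom ip Sigma Phi).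
Hypotheses (Phic : weakly_bp_continuous ip Sigma Phi).
Implicit Types (d e f g : X -> K).

Local Notation bmeas := (bmeas_fun K Sigma).
Local Notation meas := (meas_fun K Sigma).

Local Notation T f := (op_app (Phi f)).

Lemma graphP f x y : bmeas f -> Phi f (x, y) <-> T f x = y.
Proof. by case: PhiM => bPhi _ _ _ _ /bPhi; exact: bounded_opP. Qed.

Lemma app1 x : T (fun=> 1) x = x.
Proof.
have [_ E _ _ _] := PhiM; rewrite E; apply: op_appE => //; split=> //=.
- by move=> a x1 x2 y1 y2; rewrite /op_id /= => -> ->.
- by move=> x1 y1 y2; rewrite /op_id /= => -> ->.
Qed.

Lemma appD f g x : bmeas f -> bmeas g ->
  T (fun z => f z + g z) x = T f x + T g x.
Proof.
move=> bf bg; apply/graphP; first exact: bmeas_funD.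
have [_ _ [E _] _ _] := PhiM; rewrite E//.
by exists (T f x), (T g x); split=> //=; exact/graphP.
Qed.

Lemma appZ a f x : bmeas f -> T (fun z => a * f z) x = a *: T f x.
Proof.
move=> bf; apply/graphP; first exact: bmeas_funZ.
have [_ _ [_ E] _ _] := PhiM; rewrite E//.
by exists (T f x) => //=; exact/graphP.
Qed.

Lemma appM f g x : bmeas f -> bmeas g ->
  T (fun z => f z * g z) x = T f (T g x).
Proof.
move=> bf bg; apply/graphP; first exact: bmeas_funM.
have [_ _ _ E _] := PhiM; rewrite E//.
by exists (T g x) => /=; exact/graphP.
Qed.

Lemma appC f g x : bmeas f -> bmeas g -> T f (T g x) = T g (T f x).
Proof.
move=> bf bg; rewrite -!appM//; congr (op_app (Phi _) x).
by apply/funext => z; rewrite mulrC.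
Qed.

Lemma app_linear f : bmeas f -> linear (T f : H -> H).
Proof.
move=> bf a x y; apply/graphP => //.
have [bPhi _ _ _ _] := PhiM; have [[_ lin _] _ _] := bPhi _ bf.
by apply: lin; exact/graphP.
Qed.

Lemma app0 f : bmeas f -> T f 0 = 0.
Proof.
move=> bf; apply/graphP => //.
by have [bPhi _ _ _ _] := PhiM; have [[]] := bPhi _ bf.
Qed.

Lemma appDr f x y : bmeas f -> T f (x + y) = T f x + T f y.
Proof. by move=> bf; rewrite -[x]scale1r app_linear// !scale1r. Qed.

Lemma appZr f a x : bmeas f -> T f (a *: x) = a *: T f x.
Proof. by move=> bf; rewrite -[a *: x]addr0 app_linear// app0// addr0. Qed.

Lemma continuous_app f : bmeas f -> continuous (T f).
Proof.
move=> bf; have [bPhi _ _ _ _] := PhiM; have [_ _ [M bM]] := bPhi _ bf.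
move=> x; apply/cvgrPdist_lt => e e0.
have M1 : 0 < `|M| + 1 by rewrite ltr_wpDl.
near=> y.
have : Phi f (x - y, T f x - T f y).
  apply/graphP => //; rewrite -[x - y]addrC -scaleN1r app_linear//.
  by rewrite scaleN1r addrC.
move=> /bM bxy; apply: (le_lt_trans bxy).
apply: (@le_lt_trans _ _ ((`|M| + 1) * `|x - y|)).
  rewrite -[M * _]ger0_norm ?(le_trans _ bxy)// normrM normr_id.
  by rewrite ler_wpM2r// lerDl.
rewrite mulrC -ltr_pdivlMr//; near: y.
have c0 : 0 < e / (`|M| + 1) by rewrite divr_gt0.
have := @cvgr_dist_lt _ _ _ (nbhs x) _ id x (@cvg_id _ _) _ c0.
by apply.
Unshelve. all: by end_near. Qed.

(** The approximate inverses h_n = 1 / (1/(n+1) + |d|) of d satisfy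
    h_n d -> 1 pointwise and boundedly, so a vector killed by Phi d is a weak
    limit of zeros. *)
Lemma app_inj d x y : bmeas d -> (forall z, 0 < d z) -> T d x = T d y -> x = y.
Proof.
move=> bd d0 dxy; apply/subr0_eq; set u := x - y.
have du : T d u = 0.
  by rewrite /u -[x - y]addrC -scaleN1r app_linear// scaleN1r dxy addNr.
pose h n := damping n.+1%:R^-1 d.
have bh n : bmeas (h n).
  by apply: bmeas_damping bd.1 => //; rewrite invr_gt0.
have b1 := bmeas_fun_cst SigmaP (1 : K).
have bhd n : bmeas (fun z => h n z * d z) by exact: bmeas_funM.
have /(_ u u) := Phic bhd b1 (bp_cvg_damping archK d0).
rewrite app1.
under eq_fun do rewrite appM// du app0// linear0l.
move=> /(cvg_unique (@norm_hausdorff _ _) (cvg_cst _)) /esym.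
by rewrite -ipP => /eqP; rewrite expf_eq0/= normr_eq0 => /eqP.
Qed.

(** * The extension *)

(** The quotient of Phi (e f) by Phi e, for all admissible e at once. *)
Definition ext f : operator H :=
  [set p | forall e, bmeas e -> bmeas (fun z => e z * f z) ->
             T (fun z => e z * f z) p.1 = T e p.2].

(** One positive denominator decides membership: for any other e the wanted
    identity holds after applying the injective operator Phi d, because
    d (e f) = e (d f). *)
Lemma extP d f x y : bmeas d -> (forall z, 0 < d z) ->
  bmeas (fun z => d z * f z) ->
  ext f (x, y) <-> T (fun z => d z * f z) x = T d y.
Proof.
move=> bd d0 bdf; split=> [|dxy e be bef]; first exact.
apply: (app_inj bd d0) => /=.
rewrite [RHS]appC// -dxy -appM// -appM//; congr (op_app (Phi _) x).
by apply/funext => z; ring.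
Qed.

Lemma ext_bounded f : bmeas f -> ext f = Phi f.
Proof.
move=> bf; have bF : bmeas (fun z => 1 * f z) by exact: bmeas_funZ.
have b1 := bmeas_fun_cst SigmaP (1 : K).
have F1 : (fun z => 1 * f z) = f by apply/funext => z; rewrite mul1r.
apply/seteqP; split=> -[x y].
  move=> /(extP _ _ b1 (fun=> ltr01) bF).
  by rewrite F1 app1 => /(graphP _ _ bf).
move=> /(graphP _ _ bf) fxy; apply/(extP _ _ b1) => //.
by rewrite F1 app1.
Qed.

Local Notation dmp := (damping 1).

Lemma ext_dampingP f x y : meas f ->
  ext f (x, y) <-> T (fun z => dmp f z * f z) x = T (dmp f) y.
Proof.
move=> mf; apply: extP; first exact: bmeas_damping.
  by move=> z; exact: damping_gt0.
exact: bmeas_dampingM.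
Qed.

(** The common denominator of f and g serves for f + g and f g. *)
Lemma ext_damping2P f g h x y : meas f -> meas g ->
  bmeas (fun z => dmp f z * dmp g z * h z) ->
  ext h (x, y) <->
  T (fun z => dmp f z * dmp g z * h z) x = T (dmp f) (T (dmp g) y).
Proof.
move=> mf mg bh; have bf := bmeas_damping SigmaP ltr01 mf.
have bg := bmeas_damping SigmaP ltr01 mg.
rewrite -appM//; apply: extP => //; first exact: bmeas_funM.
by move=> z; rewrite mulr_gt0// damping_gt0.
Qed.

(** The graph is an intersection of equalizers of continuous maps. *)
Lemma closed_ext f : closed (ext f).
Proof.
rewrite (_ : ext f =
  \bigcap_(e in [set e | bmeas e /\ bmeas (fun z => e z * f z)])
  ((fun p => T (fun z => e z * f z) p.1 - T e p.2) @^-1` [set 0])).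
  apply: closed_bigI => e [be bef].
  apply: preimage_closed; last first.
    exact/accessible_closed_set1/hausdorff_accessible/norm_hausdorff.
  move=> p _; apply: (@cvgB _ _ _ (nbhs p)).
    by apply: continuous_comp; [exact: cvg_fst|exact: continuous_app].
  by apply: continuous_comp; [exact: cvg_snd|exact: continuous_app].
apply/seteqP; split=> [p pf e [be bef] /=|p pf e be bef].
  by rewrite pf// subrr.
by apply/subr0_eq; exact: (pf e).
Qed.

Lemma ext_linear f : meas f -> linear_op (ext f).
Proof.
move=> mf; have bd := bmeas_damping SigmaP ltr01 mf.
split=> [e be bef|a x x' y y' xy xy' e be bef|x y y'] /=.
- by rewrite !app0.
- by rewrite !app_linear// (xy e)// (xy' e).
- move=> /ext_dampingP -/(_ mf) xy /ext_dampingP -/(_ mf) xy'.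
  apply: (app_inj bd); last by rewrite -xy.
  by move=> z; exact: damping_gt0.
Qed.

Lemma ext_add f g : meas f -> meas g ->
  op_add (ext f) (ext g) `<=` ext (fun x => f x + g x).
Proof.
move=> mf mg [x w] [y [z [/= + + ->]]].
move=> /ext_dampingP -/(_ mf) xy /ext_dampingP -/(_ mg) xz.
have bf := bmeas_damping SigmaP ltr01 mf.
have bg := bmeas_damping SigmaP ltr01 mg.
have bff := bmeas_dampingM SigmaP ltr01 mf.
have bgg := bmeas_dampingM SigmaP ltr01 mg.
have E : (fun z => dmp f z * dmp g z * (f z + g z)) =
  (fun z => dmp g z * (dmp f z * f z) + dmp f z * (dmp g z * g z)).
  by apply/funext => t; ring.
apply/(ext_damping2P _ _ mf mg); rewrite E.
  by apply: bmeas_funD => //; exact: bmeas_funM.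
rewrite appD; [|exact: bmeas_funM|exact: bmeas_funM].
by rewrite (appM _ bg bff) (appM _ bf bgg) xy xz appC// -!appDr.
Qed.

Lemma ext_scale (a : K) f : meas f ->
  op_scale a (ext f) `<=` ext (fun x => a * f x).
Proof.
move=> mf [x _] [y /= /ext_dampingP -/(_ mf) xy ->].
have bf := bmeas_damping SigmaP ltr01 mf.
have bff := bmeas_dampingM SigmaP ltr01 mf.
have E : (fun z => dmp f z * (a * f z)) = (fun z => a * (dmp f z * f z)).
  by apply/funext => t; ring.
apply/(extP _ _ bf) => //; rewrite ?E.
- by move=> z; exact: damping_gt0.
- exact: bmeas_funZ.
- by rewrite appZ// xy -appZr.
Qed.

Lemma ext_comp f g : meas f -> meas g ->
  op_comp (ext f) (ext g) `<=` ext (fun x => f x * g x).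
Proof.
move=> mf mg [x z] [y /= /ext_dampingP -/(_ mg) xy /ext_dampingP -/(_ mf) yz].
have bf := bmeas_damping SigmaP ltr01 mf.
have bg := bmeas_damping SigmaP ltr01 mg.
have bff := bmeas_dampingM SigmaP ltr01 mf.
have bgg := bmeas_dampingM SigmaP ltr01 mg.
have E : (fun z => dmp f z * dmp g z * (f z * g z)) =
  (fun z => (dmp f z * f z) * (dmp g z * g z)).
  by apply/funext => t; ring.
apply/(ext_damping2P _ _ mf mg); rewrite E; first exact: bmeas_funM.
by rewrite appM// xy appC// yz appC.
Qed.

(** The domain condition for products: writing df and dg for the damping
    factors, Phi dg can be cancelled from
    Phi dg (Phi (df f) y) = Phi (df f) (Phi (dg g) x) = Phi dg (Phi df z). *)
Lemma ext_comp_dom f g x y z : meas f -> meas g ->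
  ext g (x, y) -> ext (fun x => f x * g x) (x, z) -> ext f (y, z).
Proof.
move=> mf mg /ext_dampingP -/(_ mg) xy.
have bf := bmeas_damping SigmaP ltr01 mf.
have bg := bmeas_damping SigmaP ltr01 mg.
have bff := bmeas_dampingM SigmaP ltr01 mf.
have bgg := bmeas_dampingM SigmaP ltr01 mg.
have E : (fun z => dmp f z * dmp g z * (f z * g z)) =
  (fun z => (dmp f z * f z) * (dmp g z * g z)).
  by apply/funext => t; ring.
move=> /(ext_damping2P _ _ mf mg); rewrite E appM// xy.
move=> /(_ (bmeas_funM SigmaP denseK archK bff bgg)) xz.
apply/ext_dampingP => //; apply: (app_inj bg).
  by move=> t; exact: damping_gt0.
by rewrite appC// xz appC.
Qed.

Lemma bmeas_conj f : continuous conj -> (forall a, `|conj a| = `|a|) ->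
  bmeas f -> bmeas (fun x => conj (f x)).
Proof.
move=> cc nc [mf /bounded_funP[M fM]]; split.
  exact: (meas_fun_cont SigmaP cc).
by apply/bounded_funP; exists M => x; rewrite nc.
Qed.

Lemma ext_calculus : continuous conj -> (forall a, `|conj a| = `|a|) ->
  measurable_calculus ip Sigma ext.
Proof.
move=> cc nc; have [bPhi Phi1 _ _ adjPhi] := PhiM; split.
- by move=> f mf; split; [exact: ext_linear|exact: closed_ext].
- by rewrite ext_bounded//; exact: bmeas_fun_cst.
- exact: ext_add.
- exact: ext_scale.
- exact: ext_comp.
- move=> f g mf mg; apply/seteqP; split=> x.
    move=> [z xz]; split; last by exists z; exact: ext_comp xz.
    by have [y xy _] := xz; exists y.
  by move=> [[y xy] [z xz]]; exists z, y => //; exact: ext_comp_dom xz.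
- by move=> f bf; rewrite ext_bounded//; exact: bPhi.
- move=> f bf; rewrite !ext_bounded//; last exact: bmeas_conj.
  by rewrite adjPhi.
- move=> f_ f bf_ bf ff x y; rewrite ext_bounded//.
  under eq_fun do rewrite ext_bounded//.
  exact: Phic.
Qed.

(** With d = damping 1 f, one inclusion comes from Psi d Psi f being contained
    in Phi (d f); for the other, the domain condition for the product of 1/d
    and d shows that (Phi d y, y) is in Psi (1/d), and f = (1/d) (d f). *)
Lemma ext_unique (Psi : (X -> K) -> operator H) f :
  measurable_calculus ip Sigma Psi -> extends Sigma Psi Phi -> meas f ->
  Psi f = ext f.
Proof.
move=> calc ePsi mf; have bd := bmeas_damping SigmaP ltr01 mf.
have bdf := bmeas_dampingM SigmaP ltr01 mf.
have mV := meas_fun_norm1 SigmaP mf.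
apply/seteqP; split=> -[x y].
  move=> xy; apply/ext_dampingP => //.
  apply/(graphP _ _ bdf); rewrite -ePsi//.
  apply: (mfc3_sub calc) => //; first exact: bd.1.
  by exists y => //=; rewrite ePsi//; exact/graphP.
move=> /ext_dampingP -/(_ mf) xy.
have Vd : (fun z => (1 + `|f z|) * dmp f z) = (fun=> 1).
  by apply/funext => z; rewrite mulfV// gt_eqF// ltr_wpDr.
(* From here on f is factored as (1 + |f|) (d f), with 1 + |f| = 1/d. *)
have -> : f = (fun z => (1 + `|f z|) * (dmp f z * f z)).
  apply/funext => z; rewrite mulrA.
  by have := congr1 (@^~ z) Vd => /= ->; rewrite mul1r.
apply: (mfc3_sub calc) => //; first exact: bdf.1.
exists (T (dmp f) y) => /=; first by rewrite ePsi//; exact/graphP.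
have : op_dom (op_comp (Psi (fun z => 1 + `|f z|)) (Psi (dmp f))) y.
  rewrite (mfc3_dom calc)//; last exact: bd.1.
  split; first by exists (T (dmp f) y); rewrite ePsi//; exact/graphP.
  by rewrite Vd (mfc1 calc); exists y.
move=> [z yz]; have [t /=] := yz.
rewrite ePsi// => /(graphP _ _ bd) -> dz.
have : Psi (fun=> 1) (y, z).
  by rewrite -Vd; apply: (mfc3_sub calc) yz => //; exact: bd.1.
by rewrite (mfc1 calc) /op_id /= => <-.
Qed.

End extension.

(** * Existence and uniqueness *)

Theorem theorem6p1 (R : realType) (k : scalar_kind)
    (X : Type) (Sigma : set (set X)) (SigmaP : sigma_algebra setT Sigma)
    (H : completeNormedModType (scalar_field R k))
    (ip : {dot H for @sconj R k}) (ipP : induces_norm ip)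
    (Phi : (X -> scalar_field R k) -> operator H)
    (PhiM : unital_star_hom ip Sigma Phi)
    (Phic : weakly_bp_continuous ip Sigma Phi) :
  exists Psi : (X -> scalar_field R k) -> operator H,
    [/\ measurable_calculus ip Sigma Psi,
        extends Sigma Psi Phi &
        forall Psi' : (X -> scalar_field R k) -> operator H,
          measurable_calculus ip Sigma Psi' -> extends Sigma Psi' Phi ->
          forall f, meas_fun (scalar_field R k) Sigma f -> Psi' f = Psi f].
Proof.
have denseK := scalar_dense_seq R k; have archK := @scalar_archimedean R k.
exists (ext Sigma Phi); split.
- by apply: ext_calculus => //; [exact: continuous_sconj|exact: normr_sconj].
- by move=> f bf; exact: (ext_bounded _ _ _ ipP PhiM).
- by move=> Psi calc ePsi f mf; exact: (ext_unique _ _ _ ipP PhiM).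
Qed.
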